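(* Every unary variety satisfies TImC.
   Context: A variety is unary if all of its basic operations are at most unary (i.e. of arity $0$ or $1$). A tolerance of an algebra $\mathbf A=(A;F)$ is a reflexive, symmetric relation $\tau\subseteq A^2$ compatible with all operations in $F$. If $\phi\colon\mathbf B\to\mathbf A$ is a homomorphism and $\vartheta\subseteq B^2$, write $\phi(\vartheta)=\{(\phi(a),\phi(b)):(a,b)\in\vartheta\}$. A variety $\mathcal V$ satisfies TImC (its tolerances are homomorphic images of its congruences) if for every $\mathbf A\in\mathcal V$ and every tolerance $\tau$ of $\mathbf A$ there exist an algebra $\mathbf B\in\mathcal V$, a congruence $\vartheta$ of $\mathbf B$, and a homomorphism $\phi\colon\mathbf B\to\mathbf A$ such that $\tau=\phi(\vartheta)$. *)

(* Defs.v *)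
From Stdlib Require Import ClassicalEpsilon.
From mathcomp Require Import all_boot.

Set Implicit Arguments.
Unset Strict Implicit.
Unset Printing Implicit Defensive.

Record signature : Type := Signature {
  op : Type;
  arity : op -> nat
}.

(* Algebras have a nonempty carrier, as usual in universal algebra. *)
Record algebra (S : signature) : Type := Algebra {
  carrier :> Type;
  carrier_nonempty : inhabited carrier;
  interp : forall f : op S, (arity f).-tuple carrier -> carrier
}.
Arguments interp {S} A f x : rename.

Definition is_hom (S : signature) (A B : algebra S) (h : A -> B) : Prop :=
  forall (f : op S) (x : (arity f).-tuple A),
    h (interp A f x) = interp B f (map_tuple h x).

Definition compatible (S : signature) (A : algebra S)
    (R : A -> A -> Prop) : Prop :=
  forall (f : op S) (x y : (arity f).-tuple A),
    (forall i, R (tnth x i) (tnth y i)) -> R (interp A f x) (interp A f y).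

Definition is_tolerance (S : signature) (A : algebra S)
    (R : A -> A -> Prop) : Prop :=
  [/\ forall x, R x x, forall x y, R x y -> R y x & compatible R].

Definition is_congruence (S : signature) (A : algebra S)
    (R : A -> A -> Prop) : Prop :=
  [/\ forall x, R x x, forall x y, R x y -> R y x,
      forall x y z, R x y -> R y z -> R x z & compatible R].

Definition rel_image (B A : Type) (phi : B -> A) (theta : B -> B -> Prop) :
    A -> A -> Prop :=
  fun x y => exists a b, [/\ theta a b, x = phi a & y = phi b].

Definition is_subuniverse (S : signature) (A : algebra S)
    (P : A -> Prop) : Prop :=
  forall (f : op S) (x : (arity f).-tuple A),
    (forall i, P (tnth x i)) -> P (interp A f x).

Lemma subalgebra_nonempty (A : Type) (P : A -> Prop) :
  (exists a, P a) -> inhabited {a : A | P a}.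
Proof. by case=> a Pa; exists; exists a. Qed.

Lemma subalgebra_closed (S : signature) (A : algebra S) (P : A -> Prop)
    (f : op S) (x : (arity f).-tuple {a : A | P a}) :
  is_subuniverse P -> P (interp A f (map_tuple sval x)).
Proof. by apply=> i; rewrite tnth_map; apply: svalP. Qed.

Definition subalgebra (S : signature) (A : algebra S) (P : A -> Prop)
    (P0 : exists a, P a) (Pcl : is_subuniverse P) : algebra S :=
  @Algebra S {a : A | P a} (subalgebra_nonempty P0)
    (fun f x => exist P (interp A f (map_tuple sval x))
                        (subalgebra_closed x Pcl)).

Lemma product_nonempty (I : Type) (S : signature) (A : I -> algebra S) :
  inhabited (forall i, A i).
Proof.
by exists=> i; apply: (epsilon (carrier_nonempty (A i)) (fun _ => True)).
Qed.

Definition product (S : signature) (I : Type) (A : I -> algebra S) :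
    algebra S :=
  @Algebra S (forall i, A i) (product_nonempty A)
    (fun f x i => interp (A i) f (map_tuple (fun a => a i) x)).

Record is_variety (S : signature) (V : algebra S -> Prop) : Prop := IsVariety {
  variety_H : forall (A B : algebra S) (h : A -> B),
    V A -> is_hom h -> (forall b, exists a, h a = b) -> V B;
  variety_S : forall (A : algebra S) (P : A -> Prop)
      (P0 : exists a, P a) (Pcl : is_subuniverse P),
    V A -> V (subalgebra P0 Pcl);
  (* I may be empty, so a variety contains the one-element algebra. *)
  variety_P : forall (I : Type) (A : I -> algebra S),
    (forall i, V (A i)) -> V (product A)
}.

Definition is_unary (S : signature) : Prop := forall f : op S, arity f <= 1.

Definition TImC (S : signature) (V : algebra S -> Prop) : Prop :=
  forall (A : algebra S) (tau : A -> A -> Prop), V A -> is_tolerance tau ->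
    exists (B : algebra S) (theta : B -> B -> Prop) (phi : B -> A),
      [/\ V B, is_congruence theta, is_hom phi
        & forall x y, tau x y <-> rel_image phi theta x y].

(* Main.v *)
Require Import Defs.
From mathcomp Require Import all_boot.

(** Let [tau] be a tolerance of [A] in the variety.  Record each pair of [tau]
    together with a chosen one of its two entries:
      B = { ((a, b), c) | tau a b, c = a or c = b },  a subset of A ^ 3.
    The condition [tau a b] is preserved by all operations since [tau] is
    compatible.  The condition on [c] is a disjunction, which operations of
    large arity need not preserve, as different arguments may choose different
    entries; an operation of arity at most 1 sees at most one choice and
    therefore preserves it ([marked_pair_subuniverse]).  So B is a subalgebra
    of a power of [A] and lies in the variety.

    Let theta identify the elements of B with the same underlying pair; it is
    the kernel of a homomorphism, hence a congruence.  The projection to [c] is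
    a homomorphism to [A], and it sends theta to the set of all (c, d) such that
    c and d are entries of a common pair (a, b) of [tau].  This contains [tau]
    and, by reflexivity and symmetry, is contained in it. *)

Set Implicit Arguments.
Unset Strict Implicit.
Unset Printing Implicit Defensive.

(** With at most one index, a choice made separately at each index is a uniform
    choice.  The type of choices is inhabited to cover the case of no index. *)
Lemma uniform_choice (n : nat) (T : Type) (Q : 'I_n -> T -> Prop) (t0 : T) :
  n <= 1 -> (forall i, exists t, Q i t) -> exists t, forall i, Q i t.
Proof.
case: n Q => [|[|//]] Q _ chooseQ; first by exists t0; case.
have [t Qt] := chooseQ ord0.
by exists t => i; rewrite ord1.
Qed.

Section MarkedPairs.

Variables (S : signature) (A : algebra S) (tau : A -> A -> Prop).

(** The power [A ^ 3]: the coordinates [Some false] and [Some true] hold a pair,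
    and [None] holds the marked entry, so that the mark is itself a boolean. *)
Definition cube : algebra S := product (fun _ : option bool => A).

Definition marked_pair (u : cube) : Prop :=
  tau (u (Some false)) (u (Some true)) /\ exists s, u None = u (Some s).

Lemma marked_pair_exists :
  (forall x, tau x x) -> exists u, marked_pair u.
Proof.
move=> tau_refl; have [a] := carrier_nonempty A.
by exists (fun=> a); split; last exists true.
Qed.

Lemma marked_pair_subuniverse :
  is_unary S -> compatible tau -> is_subuniverse marked_pair.
Proof.
move=> unaryS tau_comp f x Px; split.
  by apply: tau_comp => i; rewrite !tnth_map; case: (Px i).
have [s xs] : exists s, forall i, tnth x i None = tnth x i (Some s).
  by apply: uniform_choice (unaryS f) _ => [|i]; [exact: true | case: (Px i)].
exists s; congr interp.
by apply: eq_from_tnth => i; rewrite !tnth_map.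
Qed.

(** Entries of one pair of a reflexive symmetric relation are related in every
    order, including an entry with itself. *)
Lemma entries_related (u : cube) (s t : bool) :
  (forall x, tau x x) -> (forall x y, tau x y -> tau y x) ->
  marked_pair u -> tau (u (Some s)) (u (Some t)).
Proof.
by move=> tau_refl tau_sym [tau_u _]; case: s t => [] []; auto.
Qed.

End MarkedPairs.

Theorem corollary4p4 (S : signature) (V : algebra S -> Prop)
  (hV : is_variety V) (hU : is_unary S) : TImC V.
Proof.
move=> A tau VA [tau_refl tau_sym tau_comp].
pose B := subalgebra (marked_pair_exists tau_refl)
                     (marked_pair_subuniverse hU tau_comp).
pose theta (u v : B) := forall s, sval u (Some s) = sval v (Some s).
pose phi (u : B) : A := sval u None.
exists B, theta, phi; split.
- by apply: (variety_S hV); apply: (variety_P hV).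
- split=> [u s //|u v uv s|u v w uv vw s|f x y xy s].
  + by rewrite uv.
  + by rewrite uv vw.
  + congr interp; apply: eq_from_tnth => i.
    by rewrite !tnth_map; apply: xy.
- move=> f x; congr interp.
  by apply: eq_from_tnth => i; rewrite !tnth_map.
- move=> x y; split=> [xy | [u [v [uv -> ->]]]].
    (* The pair (x, y), marked once at each of its entries. *)
    pose mark (s : bool) : cube A := fun i =>
      if odflt s i then y else x.
    have markP s : marked_pair tau (mark s) by split; last exists s.
    by exists (exist _ _ (markP false)), (exist _ _ (markP true)).
  rewrite /phi; have [_ [s ->]] := svalP u; have [_ [t ->]] := svalP v.
  by rewrite -uv; apply: entries_related (svalP u).
Qed.
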